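(* No online algorithm for the online square packing problem achieves an asymptotic performance ratio of $1.680783$ (or less). That is, for every online algorithm $\mathcal{A}$ for online square packing, $R^\infty_{\mathcal{A}} > 1.680783$.
   Context: Online square packing: items arrive one by one; each item $h_i$ is an axis-parallel square of side length $s_i\in(0,1]$. Bins are unit squares. Upon arrival each item must be irrevocably assigned to a bin and a position $(x_1,x_2)$ with $0\le x_j\le 1-s_i$, so that items in the same bin do not overlap (interiors disjoint); items are placed axis-parallel and not rotated; no knowledge of future items is available. The goal is to minimize the number of used (nonempty) bins. For an input sequence $\sigma$, let $\mathcal{A}(\sigma)$ be the number of bins used by algorithm $\mathcal{A}$ and $OPT(\sigma)$ the minimum number of bins into which the items of $\sigma$ can be packed. The asymptotic performance ratio (competitive ratio) is $R^\infty_{\mathcal{A}}=\limsup_{n\to\infty}\sup_\sigma\{\mathcal{A}(\sigma)/OPT(\sigma) : OPT(\sigma)=n\}$. *)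

(* Defs.v *)
From mathcomp Require Import all_boot all_order all_algebra.
From mathcomp Require Import all_classical all_reals all_analysis.

Set Implicit Arguments.
Unset Strict Implicit.
Unset Printing Implicit Defensive.

Import Order.TTheory GRing.Theory Num.Theory.
Import numFieldNormedType.Exports.

Local Open Scope classical_set_scope.
Local Open Scope ring_scope.

Section SquarePacking.
Variable R : realType.

(* An input is the sequence of the side lengths, in order of arrival. *)
Definition valid_input (sigma : seq R) : Prop :=
  forall s, s \in sigma -> 0 < s <= 1.

(* Bins are unit squares indexed by nat; [corner] is the lower left corner of
   the item within its bin. *)
Record placement := Placement { bin : nat; corner : R * R }.

Definition region (s : R) (p : placement) : set (R * R) :=
  [set` `[(corner p).1, (corner p).1 + s]] `*`
  [set` `[(corner p).2, (corner p).2 + s]].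

Definition inside_bin (s : R) (p : placement) : Prop :=
  0 <= (corner p).1 <= 1 - s /\ 0 <= (corner p).2 <= 1 - s.

(* [P i] is where item number [i] is placed; only the values of [P] at
   [i < size sigma] matter. *)
Definition is_packing (sigma : seq R) (P : nat -> placement) : Prop :=
  (forall i, (i < size sigma)%N -> inside_bin (nth 0 sigma i) (P i)) /\
  (forall i j, (i < j < size sigma)%N -> bin (P i) = bin (P j) ->
     interior (region (nth 0 sigma i) (P i)) `&`
     interior (region (nth 0 sigma j) (P j)) = set0).

Definition bins_used (n : nat) (P : nat -> placement) : nat :=
  size (undup [seq bin (P i) | i <- iota 0 n]).

Definition packable (sigma : seq R) : set nat :=
  [set k | exists2 P, is_packing sigma P & bins_used (size sigma) P = k].

(* The default value 0 of [xget] is not used on valid inputs; see [optP]. *)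
Definition opt (sigma : seq R) : nat :=
  xget 0%N [set k | packable sigma k /\
                    forall k', packable sigma k' -> (k <= k')%N].

Lemma packable_size sigma : valid_input sigma -> packable sigma (size sigma).
Proof.
move=> v; exists (fun i => Placement i (0, 0)).
  split=> [i /(mem_nth 0)/v/andP[_ s1]|i j /andP[ij _] /= eij].
    by rewrite /inside_bin /= lexx subr_ge0 s1.
  by rewrite eij ltnn in ij.
by rewrite /bins_used /= map_id undup_id ?iota_uniq// size_iota.
Qed.

Lemma optP sigma : valid_input sigma ->
  packable sigma (opt sigma) /\
  forall k, packable sigma k -> (opt sigma <= k)%N.
Proof.
move=> v; rewrite /opt; case: xgetP => [k _ //|none].
have ex : exists k, `[< packable sigma k >].
  by exists (size sigma); apply/asboolP/packable_size.
case: (ex_minnP ex) => k /asboolP pk mk.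
by case: (none k); split=> // k' pk'; apply/mk/asboolP.
Qed.

(* A deterministic online algorithm: [decide h s] is the placement of a new
   item of side [s] arriving after the items [h].  The earlier placements are
   determined by [h], hence need not be arguments of [decide]. *)
Definition run (decide : seq R -> R -> placement) (sigma : seq R) (i : nat) :
  placement := decide (take i sigma) (nth 0 sigma i).

Record online_algorithm := OnlineAlgorithm {
  decide : seq R -> R -> placement;
  decideP : forall sigma, valid_input sigma ->
    is_packing sigma (run decide sigma)
}.

Definition cost (A : online_algorithm) (sigma : seq R) : nat :=
  bins_used (size sigma) (run (decide A) sigma).

Definition asymptotic_ratio (A : online_algorithm) : \bar R :=
  limn_esup (fun n : nat =>
    ereal_sup [set ((cost A sigma)%:R / (opt sigma)%:R)%:E
              | sigma in [set sigma | valid_input sigma /\ opt sigma = n]]).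

End SquarePacking.

(* Main.v *)
(* The adversary presents items of side 0.078, then items of side 0.251, then
   items of side about 1/3, and finally items of side about 2/3.  The sides of
   the third group are chosen adaptively by bisection, so that for some
   threshold s an item exceeds s if and only if it is the first item of its
   group in its bin.  The last items have side 1 - s: each of them can be packed
   with three items of the third group below s, but the algorithm cannot put
   any of them in a bin that contains an item of the third group.  The contents
   of the bins of the algorithm are bounded by counting grid points (a/m, b/m),
   and linear programming duality over the three stopping points (after the
   first group, after the second, at the end) shows that at one of them the
   cost is at least 1.69 times the optimum. *)

Require Import Defs.
From mathcomp Require Import all_boot all_order all_algebra.
From mathcomp Require Import all_classical all_reals all_analysis.
From mathcomp Require Import zify lra.

Set Implicit Arguments.
Unset Strict Implicit.
Unset Printing Implicit Defensive.

Import Order.TTheory GRing.Theory Num.Theory.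
Import numFieldNormedType.Exports.

Local Open Scope classical_set_scope.
Local Open Scope ring_scope.

(** * Overlapping items and grid points in a single bin *)

Section Geometry.
Variable R : realType.
Implicit Types (sigma : seq R) (P : nat -> placement R).

Lemma interior_regionP (s : R) (p : placement R) (z : R * R) :
  (corner p).1 < z.1 < (corner p).1 + s ->
  (corner p).2 < z.2 < (corner p).2 + s -> interior (region s p) z.
Proof.
move=> z1 z2; rewrite /interior /=.
exists ([set` `](corner p).1, (corner p).1 + s[],
        [set` `](corner p).2, (corner p).2 + s[]).
  by split; apply: near_in_itvoo; rewrite in_itv.
move=> [a b] [/= ha hb]; split; rewrite /= in_itv /=.
  by move: ha; rewrite in_itv /= => /andP[h1 h2]; rewrite !ltW.
by move: hb; rewrite in_itv /= => /andP[h1 h2]; rewrite !ltW.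
Qed.

Lemma itvoo_common (a b s t : R) : 0 < s -> 0 < t -> a < b + t -> b < a + s ->
  exists z, a < z < a + s /\ b < z < b + t.
Proof.
move=> s0 t0 abt bas.
have [ab|ba] := leP a b; have [h|h] := leP (a + s) (b + t).
- by exists ((b + (a + s)) / 2); split; lra.
- by exists ((b + (b + t)) / 2); split; lra.
- by exists ((a + (a + s)) / 2); split; lra.
- by exists ((a + (b + t)) / 2); split; lra.
Qed.

Lemma packing_overlap sigma P (i j : nat) : is_packing sigma P ->
  (i < size sigma)%N -> (j < size sigma)%N -> i != j -> bin (P i) = bin (P j) ->
  forall z : R * R,
  (corner (P i)).1 < z.1 < (corner (P i)).1 + nth 0 sigma i ->
  (corner (P i)).2 < z.2 < (corner (P i)).2 + nth 0 sigma i ->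
  (corner (P j)).1 < z.1 < (corner (P j)).1 + nth 0 sigma j ->
  (corner (P j)).2 < z.2 < (corner (P j)).2 + nth 0 sigma j -> False.
Proof.
move=> [_ disj] si sj nij eb z hi1 hi2 hj1 hj2.
have Ii := interior_regionP hi1 hi2; have Ij := interior_regionP hj1 hj2.
have [ij|ij|ij] := ltngtP i j; last by rewrite ij eqxx in nij.
- have := disj i j; rewrite ij sj => /(_ isT eb) /seteqP[sub _].
  by apply: (sub z); split.
- have := disj j i; rewrite ij si => /(_ isT (esym eb)) /seteqP[sub _].
  by apply: (sub z); split.
Qed.

(* The projections of both items on either axis contain a common point. *)
Lemma packing_large sigma P (i j : nat) : is_packing sigma P ->
  valid_input sigma ->
  (i < size sigma)%N -> (j < size sigma)%N -> i != j -> bin (P i) = bin (P j) ->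
  nth 0 sigma i + nth 0 sigma j <= 1.
Proof.
move=> pk v si sj nij eb; rewrite leNgt; apply/negP => gt1.
have /andP[si0 _] := v _ (mem_nth 0 si); have /andP[sj0 _] := v _ (mem_nth 0 sj).
have [/andP[i1 i1'] /andP[i2 i2']] := pk.1 i si.
have [/andP[j1 j1'] /andP[j2 j2']] := pk.1 j sj.
have common (a b : R) : 0 <= a -> a <= 1 - nth 0 sigma i -> 0 <= b ->
    b <= 1 - nth 0 sigma j ->
    exists z, a < z < a + nth 0 sigma i /\ b < z < b + nth 0 sigma j.
  by move=> *; apply: itvoo_common => //; lra.
have [z1 [hi1 hj1]] := common _ _ i1 i1' j1 j1'.
have [z2 [hi2 hj2]] := common _ _ i2 i2' j2 j2'.
exact: (packing_overlap pk si sj nij eb (z := (z1, z2))).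
Qed.

Definition grid_below (m : nat) (x : R) : nat := Num.truncn (x * m%:R).

(** The next [k] grid points after [x] span at most k/m beyond [x], and k/m is strictly less than
    [s], so even the last of them lies before the right end. *)
Lemma grid_belowP (m k a : nat) (x s : R) : (0 < m)%N -> 0 <= x -> x + s <= 1 ->
  k%:R / m%:R < s -> (grid_below m x < a <= grid_below m x + k)%N ->
  (x < a%:R / m%:R < x + s) /\ (0 < a < m)%N.
Proof.
move=> m0 x0 xs ks /andP[ga ag].
have m0' : 0 < m%:R :> R by rewrite ltr0n.
have xm0 : 0 <= x * m%:R by rewrite mulr_ge0 // ltW.
have /andP[gle glt] := truncn_itv xm0; rewrite -/(grid_below m x) -natr1 in gle glt.
have ga' : (grid_below m x)%:R + 1 <= a%:R :> R by rewrite natr1 ler_nat.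
have ag' : a%:R <= (grid_below m x)%:R + k%:R :> R by rewrite -natrD ler_nat.
have xa : x < a%:R / m%:R by rewrite ltr_pdivlMr //; lra.
have ks' : k%:R < s * m%:R by rewrite -ltr_pdivrMr.
have axs : a%:R / m%:R < x + s by rewrite ltr_pdivrMr // mulrDl; lra.
split; first by rewrite xa axs.
rewrite (leq_ltn_trans _ ga) //=.
by rewrite -(ltr_nat R) -[ltRHS]mul1r -ltr_pdivrMr //; lra.
Qed.

(* An item of side greater than k/m contains at least k^2 of the points
   (a/m, b/m), 0 < a, b < m, in its interior. *)
Lemma grid_bound sigma P (m : nat) (k : nat -> nat) (d : nat) : (0 < m)%N ->
  is_packing sigma P ->
  (forall i, (i < size sigma)%N -> (k i)%:R / m%:R < nth 0 sigma i) ->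
  (\sum_(i <- iota 0 (size sigma) | bin (P i) == d) k i ^ 2 <= m.-1 ^ 2)%N.
Proof.
move=> m0 pk hk.
(* A square block of grid points interior to item [i]; it has exactly [k i ^ 2] points even when the
   item contains more. *)
pose g i (a : nat) (b : nat) : bool :=
  ((grid_below m (corner (P i)).1 < a <= grid_below m (corner (P i)).1 + k i)
  && (grid_below m (corner (P i)).2 < b <= grid_below m (corner (P i)).2 + k i))%N.
have inpt i a b : (i < size sigma)%N -> g i a b ->
  [/\ (corner (P i)).1 < a%:R / m%:R < (corner (P i)).1 + nth 0 sigma i,
      (corner (P i)).2 < b%:R / m%:R < (corner (P i)).2 + nth 0 sigma i,
      (0 < a < m)%N & (0 < b < m)%N].
  move=> si /andP[ga gb]; have [/andP[i1 i1'] /andP[i2 i2']] := pk.1 i si.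
  have xs1 : (corner (P i)).1 + nth 0 sigma i <= 1 by lra.
  have xs2 : (corner (P i)).2 + nth 0 sigma i <= 1 by lra.
  have [h1 h1'] := grid_belowP m0 i1 xs1 (hk i si) ga.
  by have [h2 h2'] := grid_belowP m0 i2 xs2 (hk i si) gb.
have cnt c l : (c + l < m)%N -> (l <= \sum_(1 <= a < m) (c < a <= c + l))%N.
  move=> clm; rewrite (@big_cat_nat _ _ _ c.+1) //=; last by lia.
  rewrite (@big_cat_nat _ _ _ (c + l).+1 c.+1) //=; last by lia.
  rewrite [X in (_ + (X + _))%N](_ : _ = l); first by lia.
  rewrite (eq_big_nat _ _ (F2 := fun=> 1%N)); last by move=> a; lia.
  by rewrite sum_nat_const_nat; lia.
have card_g i : (i < size sigma)%N ->
    (k i ^ 2 <= \sum_(1 <= a < m) \sum_(1 <= b < m) g i a b)%N.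
  move=> si; have [k0|k0] := posnP (k i); first by rewrite k0.
  have [/andP[i1 i1'] /andP[i2 i2']] := pk.1 i si.
  (* As [k i] is positive, the block has a last index, and [grid_belowP] puts that index below
     [m]. *)
  have lt_m x : 0 <= x -> x <= 1 - nth 0 sigma i -> (grid_below m x + k i < m)%N.
    move=> x0 xs; have xs' : x + nth 0 sigma i <= 1 by lra.
    by have [] := grid_belowP (a := (grid_below m x + k i)%N) m0 x0 xs' (hk i si); lia.
  have le1 := cnt _ _ (lt_m _ i1 i1'); have le2 := cnt _ _ (lt_m _ i2 i2').
  rewrite -mulnn (leq_trans (leq_mul le1 le2)) // big_distrl /= leq_sum // => a _.
  by rewrite big_distrr /= leq_sum // => b _; rewrite /g mulnb.
(* Blocks in one bin are disjoint: a shared point would be interior to two items. *)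
have pt a b : (\sum_(i <- iota 0 (size sigma) | bin (P i) == d) g i a b <= 1)%N.
  pose s := [seq i <- iota 0 (size sigma) | (bin (P i) == d) && g i a b].
  have -> : (\sum_(i <- iota 0 (size sigma) | bin (P i) == d) g i a b)%N = size s.
    by rewrite -(sum1_size s) big_filter big_mkcondr; apply: eq_bigr => i _; case: (g i a b).
  have us : uniq s by rewrite filter_uniq // iota_uniq.
  have hs i : i \in s -> [/\ bin (P i) = d, g i a b & (i < size sigma)%N].
    by rewrite mem_filter mem_iota => /andP[/andP[/eqP]].
  case: s us hs => [|i [|j s]] //= /andP[nij _] hs.
  have [bi gi si] := hs i (mem_head _ _).
  have [|bj gj sj] := hs j; first by rewrite !inE eqxx orbT.
  have [i1 i2 _ _] := inpt _ _ _ si gi; have [j1 j2 _ _] := inpt _ _ _ sj gj.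
  exfalso; apply: (packing_overlap pk si sj _ _ (z := (a%:R / m%:R, b%:R / m%:R))) => //.
    by apply: contraNneq nij => ->; rewrite mem_head.
  by rewrite bi bj.
rewrite big_seq_cond (leq_trans (n := \sum_(i <- iota 0 (size sigma) | bin (P i) == d)
    \sum_(1 <= a < m) \sum_(1 <= b < m) g i a b)) //.
  rewrite [leqRHS]big_seq_cond leq_sum // => i /andP[]; rewrite mem_iota => /andP[_ si] _.
  exact: card_g.
(* Double counting: each of the (m - 1)^2 grid points contributes at most 1. *)
rewrite exchange_big /= (leq_trans (n := \sum_(1 <= a < m) m.-1)) //.
  apply: leq_sum => a _; rewrite exchange_big /=.
  apply: (leq_trans (n := \sum_(1 <= b < m) 1)); first by apply: leq_sum => b _.
  by rewrite sum_nat_const_nat; lia.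
by rewrite sum_nat_const_nat; lia.
Qed.
End Geometry.

(** * Packing items into prescribed slots *)

(** The r-th item of a class is sent to the r-th slot of that class. *)
Lemma class_injection (C : eqType) (x0 : C) (items slots : seq C) :
  (forall c, (count_mem c items <= count_mem c slots)%N) ->
  exists f : nat -> nat,
    (forall i, (i < size items)%N ->
       (f i < size slots)%N /\ nth x0 slots (f i) = nth x0 items i) /\
    (forall i j, (i < j < size items)%N -> f i != f j).
Proof.
move=> le_count.
pose idx c := [seq k <- iota 0 (size slots) | nth x0 slots k == c].
have size_idx c : size (idx c) = count_mem c slots.
  rewrite size_filter -[in RHS](mkseq_nth x0 slots) /mkseq count_map.
  by apply: eq_count => k /=.
pose rank i := count_mem (nth x0 items i) (take i items).
have rank_lt i : (i < size items)%N -> (rank i < size (idx (nth x0 items i)))%N.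
  move=> si; rewrite size_idx (leq_trans _ (le_count _)) //.
  rewrite -[X in (_ < count_mem _ X)%N](cat_take_drop i items) count_cat.
  by rewrite (drop_nth x0 si) /= eqxx /rank; lia.
exists (fun i => nth 0%N (idx (nth x0 items i)) (rank i)); split=> [i si|i j].
  have := mem_nth 0%N (rank_lt i si).
  by rewrite mem_filter mem_iota => /andP[/eqP-> /andP[_ ->]].
move=> /andP[ij sj]; have si := ltn_trans ij sj.
apply/eqP => eqf.
have := mem_nth 0%N (rank_lt i si); have := mem_nth 0%N (rank_lt j sj).
rewrite -eqf !mem_filter => /andP[/eqP cj _] /andP[/eqP ci _].
have eqc : nth x0 items j = nth x0 items i by rewrite -cj ci.
move: eqf; rewrite eqc => /eqP; rewrite nth_uniq; first last.
- by rewrite filter_uniq // iota_uniq.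
- by rewrite -eqc rank_lt.
- exact: rank_lt.
(* Item [i] is itself counted in the rank of [j], so two items of one class have different ranks. *)
apply/negP; rewrite neq_ltn /rank eqc; apply/orP; left.
rewrite -[X in (_ < count_mem _ (take j X))%N](cat_take_drop i items).
rewrite take_cat size_take si ifN -?leqNgt ?(ltnW ij) // count_cat (drop_nth x0 si).
by case: (j - i)%N (subn_gt0 i j) => [|l] /=; rewrite ij // eqxx; lia.
Qed.

(* A slot is a class of items together with the lower left corner of a box, in
   units of 1/1000; [slot_side] bounds the sides of the items of the class.
   The classes are 0: side 0.078, 1: side 0.251, 2: sides in ]1/3, s[,
   3: sides in ]1/3, 0.334[, 4: side 1 - s, for a real s in ]1/3, 0.334[. *)
Definition slot : Type := (nat * (nat * nat))%type.

Definition slot_side (c : nat) : nat := nth 0%N [:: 78; 251; 334; 334; 667]%N c.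

(* The box of class 4 has its true corner in (s, s), so its disjointness from
   the boxes of class 2 is not visible in units of 1/1000. *)
Definition apart (e f : slot) : bool :=
  let: (c, (x, y)) := e in let: (d, (z, t)) := f in
  [|| (x + slot_side c < z)%N, (z + slot_side d < x)%N,
      (y + slot_side c < t)%N, (t + slot_side d < y)%N |
      [&& c == 2%N, d == 4%N & (x == 0%N) || (y == 0%N)]].

(** In class 4, the coordinate 333 stands for s; with side 667 the box ends exactly at 1000. *)
Definition slot_in_bin (e : slot) : bool :=
  let: (c, (x, y)) := e in
  if c == 4%N then (x == 333%N) && (y == 333%N)
  else (x + slot_side c <= 1000)%N && (y + slot_side c <= 1000)%N.

Definition valid_bin (b : seq slot) : bool := all slot_in_bin b && pairwise apart b.

Definition class_count (c : nat) (b : seq slot) : nat := count (fun e => e.1 == c) b.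
Arguments class_count : simpl never.

Section Slots.
Variable R : realType.
Variable s : R.
Hypothesis s_bounds : 1 / 3%:R < s < 334%:R / 1000%:R.

Definition fits (c : nat) (x : R) : Prop :=
  match c with
  | 0 => x <= 78%:R / 1000%:R
  | 1 => x <= 251%:R / 1000%:R
  | 2 => x < s
  | 3 => x <= 334%:R / 1000%:R
  | 4 => x = 1 - s
  | _ => False
  end.

Definition slot_corner (e : slot) : R * R :=
  if e.1 == 4%N then (s, s) else (e.2.1%:R / 1000%:R, e.2.2%:R / 1000%:R).

(** Transfers real positions to integer boxes. Class 4 works because 333/1000 < s and s + (1 - s) =
    1. *)
Lemma slot_box (e : slot) (x : R) : slot_in_bin e -> fits e.1 x ->
  [/\ e.2.1%:R / 1000%:R <= (slot_corner e).1,
      (slot_corner e).1 + x <= (e.2.1 + slot_side e.1)%:R / 1000%:R,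
      e.2.2%:R / 1000%:R <= (slot_corner e).2,
      (slot_corner e).2 + x <= (e.2.2 + slot_side e.1)%:R / 1000%:R &
      (slot_corner e).1 + x <= 1 /\ (slot_corner e).2 + x <= 1].
Proof.
have /andP[s1 s2] := s_bounds; case: e => c [a b] /=; rewrite /slot_corner /=.
case: eqP => [-> /andP[/eqP-> /eqP->] /= ->|c4].
  by rewrite (_ : 333 + slot_side 4 = 1000)%N //; split; [..|split]; lra.
move=> /andP[]; rewrite -(ler_nat R) => ha; rewrite -(ler_nat R) => hb fc.
have xc : x <= (slot_side c)%:R / 1000%:R.
  by move: c fc c4 {ha hb} => [|[|[|[|[|c]]]]] //= ? c4; rewrite /slot_side /=;
    first [lra | case: c4].
by rewrite !(natrD _ a) !(natrD _ b) in ha hb *; split; [..|split] => /=; lra.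
Qed.

(** Strict integer gaps separate even closed boxes. In the exceptional case the class 2 item starts
    at 0 on some axis and ends before s, where the class 4 item starts. *)
Lemma apart_disjoint (e f : slot) (x y : R) (n : nat) :
  slot_in_bin e -> slot_in_bin f -> fits e.1 x -> fits f.1 y -> apart e f ->
  region x (Placement n (slot_corner e)) `&` region y (Placement n (slot_corner f)) = set0.
Proof.
move=> be bf fe ff ap; apply/seteqP; split=> // -[z1 z2] [[/=]].
rewrite !in_itv /= => /andP[e1 e1'] /andP[e2 e2'] [/=].
rewrite !in_itv /= => /andP[f1 f1'] /andP[f2 f2'].
have [ex ex' ey ey' _] := slot_box be fe.
have [fx fx' fy fy' _] := slot_box bf ff.
move: e f be bf fe ff ap e1 e1' e2 e2' f1 f1' f2 f2' ex ex' ey ey' fx fx' fy fy'.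
move=> [c [a b]] [d [a' b']] /= be bf fe ff.
have lt_real u v : (u < v)%N -> u%:R / 1000%:R < v%:R / 1000%:R :> R.
  by rewrite -(ltr_nat R); lra.
case/or4P => [/lt_real|/lt_real|/lt_real|]; try lra.
case/orP => [/lt_real|]; first lra.
case/and3P=> /eqP cE /eqP dE; rewrite /slot_corner /= cE dE /=.
rewrite cE /= in fe.
by case/orP => /eqP->; lra.
Qed.

Definition placed_slots (bins : seq (seq slot)) : seq (nat * slot) :=
  flatten [seq [seq (b, e) | e <- nth [::] bins b] | b <- iota 0 (size bins)].

Lemma count_placed_slots (bins : seq (seq slot)) (c : nat) :
  count_mem c [seq e.2.1 | e <- placed_slots bins] =
  sumn [seq class_count c b | b <- bins].
Proof.
rewrite count_map count_flatten -map_comp; congr sumn.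
rewrite -[in RHS](mkseq_nth [::] bins) /mkseq -map_comp; apply: eq_map => b /=.
by rewrite count_map; apply: eq_count => e /=.
Qed.

Lemma placed_slotsP (bins : seq (seq slot)) : all valid_bin bins ->
  pairwise (fun e f : nat * slot => (e.1 != f.1) || apart e.2 f.2) (placed_slots bins) /\
  all (fun e : nat * slot => (e.1 < size bins)%N && slot_in_bin e.2) (placed_slots bins).
Proof.
move=> /allP vb.
have vbn b : (b < size bins)%N -> valid_bin (nth [::] bins b).
  by move=> sb; apply/vb/mem_nth.
pose F n := flatten [seq [seq (b, e) | e <- nth [::] bins b] | b <- iota 0 n].
rewrite -[placed_slots bins]/(F (size bins)).
suff: forall n, (n <= size bins)%N ->
  pairwise (fun e f : nat * slot => (e.1 != f.1) || apart e.2 f.2) (F n) /\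
  all (fun e : nat * slot => (e.1 < n)%N && slot_in_bin e.2) (F n) by exact.
elim=> [//|n IH] sn; have [pF aF] := IH (ltnW sn).
have -> : F n.+1 = F n ++ [seq (n, e) | e <- nth [::] bins n].
  by rewrite /F -addn1 iotaD map_cat flatten_cat /= cats0 add0n.
have /andP[ab pb] := vbn n sn; split; last first.
  rewrite all_cat all_map; apply/andP; split.
    by apply: sub_all aF => e /andP[en ->]; rewrite ltnS ltnW.
  by apply: sub_all ab => e /= ->; rewrite ltnSn.
rewrite pairwise_cat pF pairwise_map /=; apply/andP; split; last first.
  by apply: sub_pairwise pb => e f /= ->; rewrite orbT.
apply/allrelP => e f eF /mapP[f' _ ->] /=; apply/orP; left.
by have /andP[en _] := allP aF e eF; rewrite neq_ltn en.
Qed.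

(** [class_injection] gives every item its own slot of the right class. Bounding the optimum thus
    reduces to checking bin patterns by computation and counting their slots. *)
Lemma opt_le_bins (sigma : seq R) (cls : R -> nat) (bins : seq (seq slot)) :
  valid_input sigma -> all valid_bin bins ->
  (forall x, x \in sigma -> fits (cls x) x) ->
  (forall c, (count (fun x => cls x == c) sigma <=
              sumn [seq class_count c b | b <- bins])%N) ->
  (opt sigma <= size bins)%N.
Proof.
move=> v vb fc le_count.
have [pw ins] := placed_slotsP vb.
have [|f [fP finj]] := @class_injection _ 0%N [seq cls x | x <- sigma]
    [seq e.2.1 | e <- placed_slots bins].
  by move=> c; rewrite count_placed_slots count_map (leq_trans _ (le_count c)).
rewrite !size_map in fP finj.
pose e i := nth (0, (0, (0, 0)))%N (placed_slots bins) (f i).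
pose P i := Placement (e i).1 (slot_corner (e i).2).
have eP i : (i < size sigma)%N ->
  [/\ (f i < size (placed_slots bins))%N, ((e i).1 < size bins)%N,
      slot_in_bin (e i).2 & fits (e i).2.1 (nth 0 sigma i)].
  move=> si; have [fi] := fP i si.
  rewrite (nth_map (0, (0, (0, 0)))%N) // (nth_map 0) // => fE.
  have /andP[h1 h2] := allP ins _ (mem_nth (0, (0, (0, 0)))%N fi).
  by split=> //; rewrite /e fE; apply/fc/mem_nth.
have [_ /(_ (bins_used (size sigma) P)) opt_min] := optP v.
apply: (leq_trans (opt_min _)); last first.
  rewrite /bins_used -[leqRHS](size_iota 0) uniq_leq_size ?undup_uniq // => b.
  rewrite mem_undup => /mapP[i]; rewrite mem_iota => /andP[_ si] ->.
  by rewrite mem_iota /=; have [] := eP i si.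
exists P => //; split=> [i si|i j /andP[ij sj] eb].
  have [_ _ h h'] := eP i si; have [x1 _ x2 _ [x3 x4]] := slot_box h h'.
  have pos k : 0 <= k%:R / 1000%:R :> R by rewrite divr_ge0 ?ler0n.
  by split; rewrite /= lerBrDr ?x3 ?x4 andbT; [exact: le_trans x1 | exact: le_trans x2].
have si := ltn_trans ij sj.
have [fi _ hi hi'] := eP i si; have [fj _ hj hj'] := eP j sj.
suff dis : region (nth 0 sigma i) (P i) `&` region (nth 0 sigma j) (P j) = set0.
  by apply/seteqP; split=> // z [/interior_subset zi /interior_subset zj]; rewrite -dis.
have nf : f i != f j by apply: finj; rewrite ij sj.
have /pairwiseP := pw => /(_ (0, (0, (0, 0)))%N) pw'.
have eb' : (e i).1 = (e j).1 := eb.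
rewrite /P -eb'.
(* The order of two slots in the list need not be the order in which their items arrive. *)
have [fij|fij|fij] := ltngtP (f i) (f j); last by rewrite fij eqxx in nf.
- have := pw' (f i) (f j) fi fj fij; rewrite -!/(e _) eb' eqxx /=.
  exact: apart_disjoint.
- have := pw' (f j) (f i) fj fi fij; rewrite -!/(e _) eb' eqxx /= setIC.
  exact: apart_disjoint.
Qed.
End Slots.

(** * Four explicit bin patterns *)

Definition slot_grid (c : nat) (xs ys : seq nat) : seq slot :=
  [seq (c, (x, y)) | x <- xs, y <- ys].

(** The steps 79, 252 and 335 in the patterns are nominal sides plus the gap of 1 that [apart]
    demands. *)
Definition bin_tiny : seq slot :=
  slot_grid 0 (mkseq (muln 79) 12) (mkseq (muln 79) 12).

Definition bin_quarter : seq slot :=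
  slot_grid 1 [:: 0; 252; 504]%N [:: 0; 252; 504]%N ++
  slot_grid 0 [:: 756; 835; 914]%N (mkseq (muln 79) 12) ++
  slot_grid 0 (mkseq (muln 79) 9) [:: 756; 835; 914]%N.

Definition bin_third : seq slot :=
  slot_grid 3 [:: 0; 335]%N [:: 0; 335]%N ++
  [seq (1, e) | e <- [:: (670, 0); (670, 252); (670, 670); (0, 670); (252, 670)]]%N ++
  slot_grid 0 [:: 922]%N (mkseq (muln 79) 12) ++
  slot_grid 0 (mkseq (muln 79) 11) [:: 922]%N ++
  slot_grid 0 [:: 670; 749; 828]%N [:: 504; 583]%N ++
  slot_grid 0 [:: 504; 583]%N [:: 670; 749; 828]%N.

Definition bin_big : seq slot :=
  [seq (2, e) | e <- [:: (0, 0); (335, 0); (0, 335)]]%N ++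
  [:: (4, (333, 333)); (1, (670, 0)); (1, (0, 670))]%N ++
  slot_grid 0 [:: 922]%N [:: 0; 79; 158; 237]%N ++
  slot_grid 0 [:: 0; 79; 158; 237]%N [:: 922]%N ++
  slot_grid 0 [:: 670; 749; 828]%N [:: 252]%N ++
  slot_grid 0 [:: 252]%N [:: 670; 749; 828]%N.

Lemma bin_tiny_valid : valid_bin bin_tiny. Proof. by vm_compute. Qed.
Lemma bin_quarter_valid : valid_bin bin_quarter. Proof. by vm_compute. Qed.
Lemma bin_third_valid : valid_bin bin_third. Proof. by vm_compute. Qed.
Lemma bin_big_valid : valid_bin bin_big. Proof. by vm_compute. Qed.

Lemma class_count_tiny : class_count 0 bin_tiny = 144%N.
Proof. by []. Qed.

Lemma class_count_quarter :
  (class_count 0 bin_quarter = 63%N) * (class_count 1 bin_quarter = 9%N).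
Proof. by []. Qed.

Lemma class_count_third :
  (class_count 0 bin_third = 35%N) * (class_count 1 bin_third = 5%N) *
  (class_count 2 bin_third = 0%N) * (class_count 3 bin_third = 4%N) *
  (class_count 4 bin_third = 0%N).
Proof. by []. Qed.

Lemma class_count_big :
  (class_count 0 bin_big = 14%N) * (class_count 1 bin_big = 2%N) *
  (class_count 2 bin_big = 3%N) * (class_count 3 bin_big = 0%N) *
  (class_count 4 bin_big = 1%N).
Proof. by []. Qed.

(** * The input and upper bounds on its optima *)

Section OptBounds.
Variable R : realType.

Definition tiny : R := 78%:R / 1000%:R.
Definition quarter : R := 251%:R / 1000%:R.
Definition third_range (x : R) : bool := 1 / 3%:R < x < 334%:R / 1000%:R.

(** Since 144 * 91 = 63 * 208, these items exactly fill 91k bins of pattern [bin_tiny], and also the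
    class 0 slots of 208k bins of pattern [bin_quarter]. *)
Definition first_part (k : nat) : seq R := nseq (144 * (91 * k)) tiny.
Definition second_part (k : nat) : seq R := first_part k ++ nseq (9 * (208 * k)) quarter.
Definition full_input (k : nat) (th : seq R) (l : nat) (s : R) : seq R :=
  second_part k ++ th ++ nseq l (1 - s).

Lemma full_input_valid k th l s : all third_range th -> third_range s ->
  valid_input (full_input k th l s).
Proof.
move=> /allP hth /andP[s1 s2] x; rewrite !mem_cat => /orP[/orP[]|/orP[]].
- by rewrite mem_nseq => /andP[_ /eqP->]; rewrite /tiny; lra.
- by rewrite mem_nseq => /andP[_ /eqP->]; rewrite /quarter; lra.
- by move/hth; rewrite /third_range => /andP[]; lra.
- by rewrite mem_nseq => /andP[_ /eqP->]; lra.
Qed.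

(** A sample threshold for inputs that stop before the third group. *)
Lemma third_range_mid : third_range (3335%:R / 10000%:R).
Proof. by rewrite /third_range; lra. Qed.

Lemma second_part_valid k : valid_input (second_part k).
Proof.
have := @full_input_valid k [::] 0 _ isT third_range_mid.
by rewrite /full_input /= cats0.
Qed.

Lemma first_part_valid k : valid_input (first_part k).
Proof. by move=> x xin; apply: (@second_part_valid k); rewrite mem_cat xin. Qed.

Lemma opt_first_part k : (opt (first_part k) <= 91 * k)%N.
Proof.
rewrite -[leqRHS](size_nseq _ bin_tiny).
apply: (opt_le_bins third_range_mid (cls := fun=> 0%N)).
- exact: first_part_valid.
- by rewrite all_nseq bin_tiny_valid orbT.
- by move=> x; rewrite mem_nseq => /andP[_ /eqP->] /=; rewrite /tiny lexx.
- move=> c; rewrite map_nseq sumn_nseq count_nseq /=.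
  by case: c => [|c]; rewrite ?class_count_tiny /=; lia.
Qed.

Lemma opt_second_part k : (opt (second_part k) <= 208 * k)%N.
Proof.
have ntq : (quarter == tiny) = false by apply/eqP; rewrite /quarter /tiny; lra.
rewrite -[leqRHS](size_nseq _ bin_quarter).
apply: (opt_le_bins third_range_mid (cls := fun x => (x != tiny) : nat)).
- exact: second_part_valid.
- by rewrite all_nseq bin_quarter_valid orbT.
- move=> x; rewrite mem_cat => /orP[]; rewrite mem_nseq => /andP[_ /eqP->].
    by rewrite eqxx /= /tiny lexx.
  by rewrite ntq /= /quarter lexx.
- move=> c; rewrite map_nseq sumn_nseq count_cat !count_nseq /= eqxx ntq /=.
  by case: c => [|[|c]] //=; rewrite class_count_quarter; lia.
Qed.

(** Uses [a] bins [bin_big] and [b] bins [bin_third]. Classes 0 and 1 occur in the ratio 7 : 1 in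
    both patterns and in the input, so one capacity inequality serves both classes. *)
Lemma opt_full_input k th l s a b : all third_range th -> third_range s ->
  (count (fun x => (x < s)%R) th <= 3 * a)%N ->
  (count (fun x => (s <= x)%R) th <= 4 * b)%N -> (l <= a)%N ->
  (9 * (208 * k) <= 2 * a + 5 * b)%N ->
  (opt (full_input k th l s) <= a + b)%N.
Proof.
set nS := count (fun x => x < s) th; set nL := count (fun x => s <= x) th.
move=> hth hs cS cL la cap.
have /andP[s1 s2] := hs.
have -> : (a + b)%N = size (nseq a bin_big ++ nseq b bin_third).
  by rewrite size_cat !size_nseq.
pose cls x := if x == tiny then 0%N else if x == quarter then 1%N
  else if x < s then 2%N else if x < 334%:R / 1000%:R then 3%N else 4%N.
have cls_tiny : cls tiny = 0%N by rewrite /cls eqxx.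
have cls_quarter : cls quarter = 1%N.
  by rewrite /cls eqxx ifF //; apply/eqP; rewrite /quarter /tiny; lra.
have cls_third x : third_range x -> cls x = if x < s then 2%N else 3%N.
  move=> /andP[x1 x2]; rewrite /cls x2.
  rewrite ifF; last by apply/eqP; rewrite /tiny; lra.
  by rewrite ifF //; apply/eqP; rewrite /quarter; lra.
have cls_big : cls (1 - s) = 4%N.
  rewrite /cls ifF; last by apply/eqP; rewrite /tiny; lra.
  rewrite ifF; last by apply/eqP; rewrite /quarter; lra.
  by rewrite !ifF //; apply/negbTE; rewrite -leNgt; lra.
apply: (opt_le_bins hs (cls := cls)).
- exact: full_input_valid.
- by rewrite all_cat !all_nseq bin_big_valid bin_third_valid !orbT.
- move=> x; rewrite !mem_cat => /orP[/orP[]|/orP[]].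
  + by rewrite mem_nseq => /andP[_ /eqP->]; rewrite cls_tiny; exact: lexx.
  + by rewrite mem_nseq => /andP[_ /eqP->]; rewrite cls_quarter; exact: lexx.
  + move/(allP hth) => xr; rewrite cls_third //; case: ifP => //= _.
    by case/andP: xr => _ /ltW.
  + by rewrite mem_nseq => /andP[_ /eqP->]; rewrite cls_big.
- move=> c; rewrite map_cat !map_nseq sumn_cat !sumn_nseq !count_cat !count_nseq.
  rewrite /= cls_tiny cls_quarter cls_big.
  have -> : count (fun x => cls x == c) th =
      count (fun x => (if x < s then 2%N else 3%N) == c) th.
    by apply: eq_in_count => x xth; rewrite cls_third // (allP hth).
  have c2 : count (fun x => (if x < s then 2%N else 3%N) == 2%N) th = nS.
    by apply: eq_count => x; case: (x < s).
  have c3 : count (fun x => (if x < s then 2%N else 3%N) == 3%N) th = nL.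
    by apply: eq_count => x /=; rewrite leNgt; case: (x < s).
  have cn d : d != 2%N -> d != 3%N ->
      count (fun x => (if x < s then 2%N else 3%N) == d) th = 0%N.
    move=> d2 d3; apply/eqP; rewrite -leqn0 leqNgt -has_count; apply/hasPn => x _ /=.
    by case: ifP => _; rewrite eq_sym.
  by case: c => [|[|[|[|[|c]]]]] /=; rewrite ?class_count_big ?class_count_third
     ?c2 ?c3 ?cn //=; lia.
Qed.
End OptBounds.

(** * Adaptive choice of the third group *)

Section Adversary.
Variable R : realType.
Variable A : online_algorithm R.

Let item_bin (sigma : seq R) (i : nat) : nat := bin (run (decide A) sigma i).

(** Repetitions are kept: multiplicities count the items in a bin, and [undup] leaves the bins
    themselves. *)
Definition bins_after (sigma tau : seq R) : seq nat :=
  [seq item_bin (sigma ++ tau) i | i <- iota (size sigma) (size tau)].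

(** This is where being online enters: later items cannot change earlier placements. *)
Lemma run_cat (sigma tau : seq R) i : (i < size sigma)%N ->
  run (decide A) (sigma ++ tau) i = run (decide A) sigma i.
Proof. by move=> si; rewrite /run take_cat nth_cat si. Qed.

Lemma bins_after_cat (sigma tau rho : seq R) :
  bins_after sigma (tau ++ rho) = bins_after sigma tau ++ bins_after (sigma ++ tau) rho.
Proof.
rewrite /bins_after size_cat iotaD map_cat size_cat catA; congr (_ ++ _).
apply/eq_in_map => i; rewrite mem_iota => /andP[_ si].
by rewrite /item_bin run_cat // size_cat.
Qed.

Lemma cost_bins_after (sigma : seq R) : cost A sigma = size (undup (bins_after [::] sigma)).
Proof. by []. Qed.

(* Bisection: the first item of side about 1/3 in its bin turns out to be
   larger than the threshold, every further one smaller. *)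
Lemma adaptive_thirds (sigma : seq R) (q : nat) :
  exists th : seq R, exists s : R,
    [/\ size th = q, all (@third_range R) th, third_range s,
        count (fun x => s <= x) th = size (undup (bins_after sigma th)) &
        forall d, d \in bins_after sigma th ->
          exists2 i, (i < q)%N & nth 0%N (bins_after sigma th) i = d /\ s < nth 0 th i].
Proof.
(* Invariant of the bisection: no item lies strictly between [lo] and [hi], and those from [hi]
   upwards are one per bin. Any threshold inside the gap then works. *)
suff [th [lo [hi [[sz ran] lohi cnt gap large]]]] :
  exists th : seq R, exists lo hi : R,
    [/\ size th = q /\ all (@third_range R) th,
        [/\ 1 / 3%:R <= lo, lo < hi & hi <= 334%:R / 1000%:R],
        count (fun x => hi <= x) th = size (undup (bins_after sigma th)),
        (forall x, x \in th -> x <= lo \/ hi <= x) &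
        forall d, d \in bins_after sigma th ->
          exists2 i, (i < q)%N & nth 0%N (bins_after sigma th) i = d /\ hi <= nth 0 th i].
  case: lohi => lo1 lohi hi1.
  exists th, ((lo + hi) / 2%:R); split=> //.
  - by rewrite /third_range; lra.
  - rewrite -cnt; apply: eq_in_count => x /gap[] h.
      by rewrite !leNgt; congr negb; lra.
    by rewrite h; lra.
  - by move=> d /large[i iq [bi hi2]]; exists i => //; split=> //; lra.
elim: q => [|q [th [lo [hi [[sz ran] [lo1 lohi hi1] cnt gap large]]]]].
  exists [::], (1 / 3%:R), (334%:R / 1000%:R); split=> //.
  by split; lra.
pose v := (lo + hi) / 2%:R.
have bE : bins_after sigma (rcons th v) =
    rcons (bins_after sigma th) (bin (decide A (sigma ++ th) v)).
  rewrite -cats1 bins_after_cat -cats1; congr (_ ++ _).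
  by rewrite /bins_after /= /item_bin /run take_size_cat // nth_cat ltnn subnn.
set d := bin _ in bE; set tb := bins_after sigma th in cnt large bE.
have size_tb : size tb = q by rewrite size_map size_iota sz.
have size_rcons_undup : size (undup (rcons tb d)) = ((d \notin tb) + size (undup tb))%N.
  rewrite (perm_size (perm_undup (mem_rcons tb d))) /=.
  by case: ifP.
have ran' : all (@third_range R) (rcons th v).
  by rewrite all_rcons ran andbT /third_range /v; lra.
have large_old h e : h <= hi -> e \in tb -> exists2 i, (i < q.+1)%N &
    nth 0%N (rcons tb d) i = e /\ h <= nth 0 (rcons th v) i.
  move=> hh /large[i iq [bi hi2]]; exists i; first by rewrite ltnS ltnW.
  by rewrite !nth_rcons size_tb sz iq; split=> //; rewrite (le_trans hh).
(* If bin [d] already holds an item of the group, [v] is small and [lo] moves up to it; otherwise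
   [v] is large and [hi] moves down to it. *)
have [dtb|dtb] := boolP (d \in tb); rewrite dtb /= in size_rcons_undup.
- exists (rcons th v), v, hi; rewrite bE; split.
  + by rewrite size_rcons sz.
  + by rewrite /v; split; lra.
  + rewrite size_rcons_undup -cnt -cats1 count_cat /= addn0.
    by rewrite (_ : hi <= v = false) ?addn0 //; apply/negbTE; rewrite -ltNge /v; lra.
  + move=> x; rewrite mem_rcons inE => /orP[/eqP->|/gap[]h]; [left| |right]=> //.
    by left; rewrite /v; lra.
  + move=> e; rewrite mem_rcons inE => /orP[/eqP->|]; exact: large_old.
- exists (rcons th v), lo, v; rewrite bE; split.
  + by rewrite size_rcons sz.
  + by rewrite /v; split; lra.
  + rewrite size_rcons_undup -cnt -cats1 count_cat /= lexx addn0 addnC; congr addn.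
    apply: eq_in_count => x /gap[] h; last by rewrite h; rewrite /v; lra.
    by rewrite !leNgt; congr negb; rewrite /v; lra.
  + move=> x; rewrite mem_rcons inE => /orP[/eqP->|/gap[]h]; [by right|by left|].
    by right; rewrite /v; lra.
  + move=> e; rewrite mem_rcons inE => /orP[/eqP->|]; last first.
      by apply: large_old; rewrite /v; lra.
    by exists q => //; rewrite !nth_rcons size_tb sz ltnn eqxx.
Qed.
End Adversary.

(** * Weights summed over the bins *)

Lemma size_sum_count (s : seq nat) (n : nat) : all (fun d => d < n)%N s ->
  size s = (\sum_(d < n) count_mem (d : nat) s)%N.
Proof.
elim: s => [_|x s IH /= /andP[xn sn]]; first by rewrite big1.
rewrite big_split /= -IH // (bigD1 (Ordinal xn)) //= eqxx big1 ?addn0 //.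
by move=> i; rewrite -val_eqE /= eq_sym => /negbTE->.
Qed.

Lemma size_undup_sum (s : seq nat) (n : nat) : all (fun d => d < n)%N s ->
  size (undup s) = (\sum_(d < n) (0 < count_mem (d : nat) s)%N)%N.
Proof.
move=> sn; rewrite (@size_sum_count _ n); last first.
  by apply/allP => x; rewrite mem_undup => /(allP sn).
apply: eq_bigr => d _; rewrite count_uniq_mem ?undup_uniq // mem_undup.
by rewrite -has_count has_pred1.
Qed.

(* The weights 13, 117, 117, 576 of the four kinds of items, the bonus 108 of a
   bin with an item of side about 1/3, and the multipliers 728, 585, 576 of the
   three stopping points are a dual solution of the linear program that
   describes the algorithm's choice of bin contents. *)
Lemma bin_weight (r p q b : nat) :
  (r + 9 * p + 16 * q + 64 * b <= 144)%N -> (p + q + 4 * b <= 9)%N ->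
  (q <= 4)%N -> (b <= 1)%N -> ((0 < q) ==> (b == 0))%N ->
  (13 * r + 117 * p + 117 * q + 576 * b + 108 * (0 < q) <=
   728 * (0 < r) + 585 * (0 < r + p) + 576 * (0 < r + (p + (q + b))))%N.
Proof.
case: q => [|[|[|[|[|q]]]]] //=; case: b => [|[|b]] //=; case: r => [|r]; case: p => [|p] //=; lia.
Qed.

Lemma total_weight (sU sT sQ sB : seq nat) :
  (forall d, [/\
    (count_mem d sU + 9 * count_mem d sT + 16 * count_mem d sQ + 64 * count_mem d sB <= 144)%N,
    (count_mem d sT + count_mem d sQ + 4 * count_mem d sB <= 9)%N,
    (count_mem d sQ <= 4)%N, (count_mem d sB <= 1)%N &
    ((0 < count_mem d sQ) ==> (count_mem d sB == 0))%N]) ->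
  (13 * size sU + 117 * size sT + 117 * size sQ + 576 * size sB + 108 * size (undup sQ) <=
   728 * size (undup sU) + 585 * size (undup (sU ++ sT)) +
   576 * size (undup (sU ++ sT ++ sQ ++ sB)))%N.
Proof.
move=> h; pose s := sU ++ sT ++ sQ ++ sB; pose n := (\max_(d <- s) d).+1.
have sn : all (fun d => d < n)%N s.
  by apply/allP => d ds; rewrite ltnS; exact: (leq_bigmax_seq d ds isT).
move: (sn); rewrite !all_cat => /and4P[nU nT nQ nB].
have nUT : all (fun d => d < n)%N (sU ++ sT) by rewrite all_cat nU.
rewrite (size_sum_count nU) (size_sum_count nT) (size_sum_count nQ) (size_sum_count nB).
rewrite (size_undup_sum nU) (size_undup_sum nUT) (size_undup_sum nQ) (size_undup_sum sn).
rewrite !big_distrr -!big_split /= leq_sum // => d _.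
have [h1 h2 h3 h4 h5] := h d; rewrite !count_cat.
exact: (bin_weight h1 h2 h3 h4 h5).
Qed.

Lemma size_le_undup (s : seq nat) (c : nat) : (forall d, count_mem d s <= c)%N ->
  (size s <= c * size (undup s))%N.
Proof.
move=> h; pose n := (\max_(d <- s) d).+1.
have sn : all (fun d => d < n)%N s.
  by apply/allP => d ds; rewrite ltnS; exact: (leq_bigmax_seq d ds isT).
rewrite (size_sum_count sn) (size_undup_sum sn) big_distrr leq_sum //= => d _.
by case: posnP => [->|_] //; rewrite muln1.
Qed.

(** Each item contains one of the 12^2 = 144 grid points for m = 13. This forces the optimum to
    grow, as the limit superior requires. *)
Lemma size_le_opt (R : realType) (sigma : seq R) : valid_input sigma ->
  (forall x, x \in sigma -> 1 / 13%:R < x) -> (size sigma <= 144 * opt sigma)%N.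
Proof.
move=> v h; have [[P pk <-] _] := optP v.
rewrite -[leqLHS](size_iota 0) -(size_map (fun i => bin (P i))).
apply: size_le_undup => d.
have := @grid_bound R sigma P 13 (fun=> 1%N) d isT pk.
rewrite -sum1_count big_map /= => -> // i si.
by apply/h/mem_nth.
Qed.

(** * Lower bound on the cost of the algorithm *)

Section LowerBound.
Variable R : realType.
Variable A : online_algorithm R.

(** With [W] the squared grid width of an item, this is the sum in [grid_bound], in a form that
    splits along the groups of the input. *)
Definition bin_load (W : R -> nat) (d : nat) (sigma tau : seq R) : nat :=
  \sum_(i <- iota (size sigma) (size tau) | bin (run (decide A) (sigma ++ tau) i) == d)
    W (nth 0%R (sigma ++ tau) i).

Lemma bin_load_cat W d (sigma tau rho : seq R) :
  bin_load W d sigma (tau ++ rho) =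
  (bin_load W d sigma tau + bin_load W d (sigma ++ tau) rho)%N.
Proof.
rewrite /bin_load size_cat iotaD big_cat /= size_cat catA; congr addn.
rewrite big_seq_cond [RHS]big_seq_cond; apply: eq_big => i.
  case: (boolP (i \in _)) => //=; rewrite mem_iota => /andP[_ si].
  by rewrite run_cat // size_cat.
by rewrite mem_iota => /andP[/andP[_ si] _]; rewrite nth_cat size_cat si.
Qed.

Lemma bin_load_const W d (sigma tau : seq R) (c : nat) :
  (forall x, x \in tau -> W x = c) ->
  bin_load W d sigma tau = (c * count_mem d (bins_after A sigma tau))%N.
Proof.
move=> Wc; rewrite count_map -sum1_count big_distrr /= /bin_load.
rewrite big_seq_cond [RHS]big_seq_cond; apply: eq_bigr => i.
rewrite mem_iota => /andP[/andP[i1 i2] _]; rewrite muln1 nth_cat ltnNge i1 /=.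
by apply/Wc/mem_nth; rewrite ltn_subLR.
Qed.

Section Final.
Variables (k l : nat) (th : seq R) (s : R).
Hypotheses (th_range : all (@third_range R) th) (s_range : third_range s).

Let sigma := full_input k th l s.
Let sU := bins_after A [::] (first_part R k).
Let sT := bins_after A (first_part R k) (nseq (9 * (208 * k)) (quarter R)).
Let sQ := bins_after A (second_part R k) th.
Let sB := bins_after A (second_part R k ++ th) (nseq l (1 - s)).

(** Turns [grid_bound] into a linear inequality between the group counts of one bin. The last two
    bounds may be weak, since the items of these groups strictly exceed 1/3 and 666/1000. *)
Lemma final_grid_bound (m a0 a1 a2 a3 d : nat) : (0 < m)%N ->
  a0%:R / m%:R < tiny R -> a1%:R / m%:R < quarter R ->
  a2%:R / m%:R <= 1 / 3%:R :> R -> a3%:R / m%:R <= 666%:R / 1000%:R :> R ->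
  (a0 ^ 2 * count_mem d sU + (a1 ^ 2 * count_mem d sT +
   (a2 ^ 2 * count_mem d sQ + a3 ^ 2 * count_mem d sB)) <= m.-1 ^ 2)%N.
Proof.
move=> m0 h0 h1 h2 h3; have /andP[s1 s2] := s_range.
(* Reads the grid width off the side; 1/10, 3/10 and 4/10 separate the groups. *)
pose K (x : R) := if x < 1 / 10%:R then a0 else if x < 3%:R / 10%:R then a1
  else if x < 4%:R / 10%:R then a2 else a3.
have KU : K (tiny R) = a0 by rewrite /K ifT // /tiny; lra.
have KT : K (quarter R) = a1.
  rewrite /K ifF; first by rewrite ifT // /quarter; lra.
  by apply/negbTE; rewrite -leNgt /quarter; lra.
have KQ x : third_range x -> K x = a2.
  move=> /andP[x1 x2]; rewrite /K ifF; last by apply/negbTE; rewrite -leNgt; lra.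
  by rewrite ifF; [rewrite ifT //; lra|apply/negbTE; rewrite -leNgt; lra].
have KB : K (1 - s) = a3.
  by rewrite /K !ifF //; apply/negbTE; rewrite -leNgt; lra.
have Kside x : x \in sigma -> (K x)%:R / m%:R < x.
  rewrite !mem_cat => /orP[/orP[]|/orP[]].
  - by rewrite mem_nseq => /andP[_ /eqP->]; rewrite KU.
  - by rewrite mem_nseq => /andP[_ /eqP->]; rewrite KT.
  - by move/(allP th_range) => xr; rewrite KQ //; case/andP: xr => x1 _; lra.
  - by rewrite mem_nseq => /andP[_ /eqP->]; rewrite KB; lra.
have v : valid_input sigma by exact: full_input_valid.
have := @grid_bound R sigma _ m (fun i => K (nth 0 sigma i)) d m0 (decideP A v)
  (fun i si => Kside _ (mem_nth 0 si)).
have <- : bin_load (fun x => (K x ^ 2)%N) d [::] sigma =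
    (\sum_(i <- iota 0 (size sigma) | bin (run (decide A) sigma i) == d)
       K (nth 0%R sigma i) ^ 2)%N by [].
rewrite /sigma /full_input /second_part -[X in bin_load _ _ _ X]catA !bin_load_cat.
rewrite (@bin_load_const _ _ _ _ (a0 ^ 2)); last first.
  by move=> x; rewrite mem_nseq => /andP[_ /eqP->]; rewrite KU.
rewrite (@bin_load_const _ _ _ _ (a1 ^ 2)); last first.
  by move=> x; rewrite mem_nseq => /andP[_ /eqP->]; rewrite KT.
rewrite (@bin_load_const _ _ _ _ (a2 ^ 2)); last first.
  by move=> x /(allP th_range) xr; rewrite KQ.
rewrite (@bin_load_const _ _ _ _ (a3 ^ 2)); last first.
  by move=> x; rewrite mem_nseq => /andP[_ /eqP->]; rewrite KB.
by [].
Qed.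

(** A bin used by the third group holds an item larger than s, and no item of side 1 - s fits beside
    it by [packing_large]. *)
Lemma final_third_big (d : nat) :
  (forall e, e \in sQ ->
     exists2 i, (i < size th)%N & nth 0%N sQ i = e /\ s < nth 0 th i) ->
  ((0 < count_mem d sQ) ==> (count_mem d sB == 0))%N.
Proof.
move=> large; rewrite -has_count has_pred1; apply/implyP => /large[i si [bi si']].
rewrite -leqn0 leqNgt -has_count has_pred1; apply/negP => /(nthP 0%N)[j].
rewrite size_map size_iota size_nseq => jl bj.
have v : valid_input sigma by exact: full_input_valid.
pose i' := (size (second_part R k) + i)%N.
pose j' := (size (second_part R k ++ th) + j)%N.
have i'lt : (i' < size (second_part R k ++ th))%N by rewrite size_cat ltn_add2l.
have sE : sigma = (second_part R k ++ th) ++ nseq l (1 - s) by rewrite -catA.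
have j'lt : (j' < size sigma)%N by rewrite sE size_cat size_nseq ltn_add2l.
have i'lt' : (i' < size sigma)%N by rewrite sE size_cat ltn_addr.
have bi' : bin (run (decide A) sigma i') = d.
  rewrite sE run_cat //; move: bi.
  by rewrite (nth_map 0%N) ?size_iota // nth_iota.
have bj' : bin (run (decide A) sigma j') = d.
  by move: bj; rewrite (nth_map 0%N) ?size_iota ?size_nseq // nth_iota ?size_nseq // sE.
have nij : i' != j' by rewrite neq_ltn (leq_trans i'lt) // leq_addr.
have := packing_large (decideP A v) v i'lt' j'lt nij (etrans bi' (esym bj')).
rewrite sE nth_cat i'lt nth_cat ltnNge leq_addr /= addKn.
by rewrite nth_cat ltnNge leq_addr /= addKn nth_nseq jl; lra.
Qed.

Lemma final_weight :
  (forall e, e \in sQ ->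
     exists2 i, (i < size th)%N & nth 0%N sQ i = e /\ s < nth 0 th i) ->
  (13 * (144 * (91 * k)) + 117 * (9 * (208 * k)) + 117 * size th + 576 * l +
     108 * size (undup sQ) <=
   728 * cost A (first_part R k) + 585 * cost A (second_part R k) +
     576 * cost A sigma)%N /\ (size th <= 4 * size (undup sQ))%N.
Proof.
move=> large.
have grid d : [/\
    (count_mem d sU + 9 * count_mem d sT + 16 * count_mem d sQ + 64 * count_mem d sB <= 144)%N,
    (count_mem d sT + count_mem d sQ + 4 * count_mem d sB <= 9)%N,
    (count_mem d sQ <= 4)%N, (count_mem d sB <= 1)%N &
    ((0 < count_mem d sQ) ==> (count_mem d sB == 0))%N].
  (* The grids with m = 13, 4, 3, 2 give the first four inequalities in turn. *)
  have [] : [/\ 1 / 13%:R < tiny R, 3%:R / 13%:R < quarter R,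
     4%:R / 13%:R <= 1 / 3%:R :> R & 8%:R / 13%:R <= 666%:R / 1000%:R :> R].
    by rewrite /tiny /quarter; split; lra.
  move=> /(@final_grid_bound 13 1 3 4 8 d isT) h /h{}h /h{}h /h{}h.
  have [] : [/\ 0 / 4%:R < tiny R, 1 / 4%:R < quarter R,
     1 / 4%:R <= 1 / 3%:R :> R & 2%:R / 4%:R <= 666%:R / 1000%:R :> R].
    by rewrite /tiny /quarter; split; lra.
  move=> /(@final_grid_bound 4 0 1 1 2 d isT) h' /h'{}h' /h'{}h' /h'{}h'.
  have [] : [/\ 0 / 3%:R < tiny R, 0 / 3%:R < quarter R,
     1 / 3%:R <= 1 / 3%:R :> R & 0 / 3%:R <= 666%:R / 1000%:R :> R].
    by rewrite /tiny /quarter; split; lra.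
  move=> /(@final_grid_bound 3 0 0 1 0 d isT) h'' /h''{}h'' /h''{}h'' /h''{}h''.
  have [] : [/\ 0 / 2%:R < tiny R, 0 / 2%:R < quarter R,
     0 / 2%:R <= 1 / 3%:R :> R & 1 / 2%:R <= 666%:R / 1000%:R :> R].
    by rewrite /tiny /quarter; split; lra.
  move=> /(@final_grid_bound 2 0 0 0 1 d isT) g /g{}g /g{}g /g{}g.
  by split; [..|exact: final_third_big]; lia.
split; last first.
  have <- : size sQ = size th by rewrite size_map size_iota.
  by apply: size_le_undup => d; have [] := grid d.
have := total_weight grid.
rewrite !size_map !size_iota !size_nseq.
have -> : sU ++ sT = bins_after A [::] (second_part R k) by rewrite bins_after_cat.
have -> : sU ++ sT ++ sQ ++ sB = bins_after A [::] sigma.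
  by rewrite /sigma /full_input /second_part -catA !bins_after_cat.
by rewrite -!cost_bins_after.
Qed.
End Final.

Lemma hard_input (n : nat) : exists2 sigma : seq R, valid_input sigma &
  (n < opt sigma)%N /\ (169 * opt sigma <= 100 * cost A sigma)%N.
Proof.
pose k := n.+1.
have [th [s [sz ran sr cnt large]]] := adaptive_thirds A (second_part R k) (2304 * k).
pose x := size (undup (bins_after A (second_part R k) th)).
(* One large item for every three small items of the third group, as in [bin_big]. *)
pose l := ((2304 * k - x) %/ 3)%N; pose sigma := full_input k th l s.
have cS : (count (fun y => (y < s)%R) th + x = 2304 * k)%N.
  rewrite /x -cnt -sz -[RHS](count_predC (fun y => (y < s)%R)); congr addn.
  by apply: eq_count => y /=; rewrite leNgt.
have [] := @final_weight k l th s ran sr; first by rewrite sz.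
rewrite -/sigma -/x sz => weight x4.
have opt1 := opt_first_part R k; have opt2 := opt_second_part R k.
(* The capacity is at least 2 (2304k - x)/3 + 5x/4 = 1536k + 7x/12. As x >= 576k, this reaches 9 *
   208k. *)
have opt3 : (opt sigma <= l.+1 + (x %/ 4).+1)%N.
  by apply: opt_full_input => //; [|rewrite cnt -/x|..]; rewrite /l; lia.
have v : valid_input sigma by exact: full_input_valid.
(* A prefix containing the whole first group has optimum at least 91k, and k = n + 1. *)
have big tau rho : sigma = tau ++ rho -> (144 * (91 * k) <= size tau)%N ->
    (n < opt tau)%N.
  move=> sE st.
  have vt : valid_input tau by move=> y yt; apply: v; rewrite sE mem_cat yt.
  have := @size_le_opt R tau vt.
  suff h : forall y, y \in tau -> 1 / 13%:R < y by move=> /(_ h); lia.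
  move=> y yt; have : y \in sigma by rewrite sE mem_cat yt.
  case/andP: sr => s1 s2.
  rewrite !mem_cat => /orP[/orP[]|/orP[]].
  - by rewrite mem_nseq => /andP[_ /eqP->]; rewrite /tiny; lra.
  - by rewrite mem_nseq => /andP[_ /eqP->]; rewrite /quarter; lra.
  - by move/(allP ran) => /andP[y1 _]; lra.
  - by rewrite mem_nseq => /andP[_ /eqP->]; lra.
have [c1|c1] := leqP (169 * opt (first_part R k)) (100 * cost A (first_part R k)).
  exists (first_part R k); [exact: first_part_valid|split=> //].
  apply: (big _ (nseq (9 * (208 * k)) (quarter R) ++ th ++ nseq l (1 - s))).
    by rewrite /sigma /full_input /second_part -!catA.
  by rewrite size_nseq.
have [c2|c2] := leqP (169 * opt (second_part R k)) (100 * cost A (second_part R k)).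
  exists (second_part R k); [exact: second_part_valid|split=> //].
  apply: (big _ (th ++ nseq l (1 - s))) => //.
  by rewrite size_cat !size_nseq leq_addr.
exists sigma => //; split.
  by apply: (big _ [::]); rewrite ?cats0 // !size_cat !size_nseq; lia.
(* Up to rounding, the total weight is 1101312k - 84x and the weighted optima sum to at most 630296k
   - 48x. For x <= 2304k the quotient exceeds 1.74, and the slack over 1.69 absorbs the rounding. *)
by rewrite /l in weight opt3; lia.
Qed.
End LowerBound.

Theorem theorem1 (R : realType) (A : online_algorithm R) :
  ((1680%:R / 10%:R ^+ 3 + 783%:R / 10%:R ^+ 6)%:E < asymptotic_ratio A)%E.
Proof.
apply: (@lt_le_trans _ _ (169%:R / 100%:R)%:E); first by rewrite lte_fin; lra.
(* The limit superior is an infimum of suprema over sets [V] containing all numbers from some [m]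
   on; a hard input with optimum above [m] bounds each supremum. *)
apply: le_ereal_inf_tmp => _ [V [m _ mV] <-].
have [sigma v [big ratio]] := hard_input A m.
apply: (@le_trans _ _ ((cost A sigma)%:R / (opt sigma)%:R)%:E).
  rewrite lee_fin ler_pdivlMr ?ltr0n; last exact: leq_ltn_trans big.
  have : 169%:R * (opt sigma)%:R <= 100%:R * (cost A sigma)%:R :> R.
    by rewrite -!natrM ler_nat.
  by lra.
apply: (@le_trans _ _ (ereal_sup [set ((cost A tau)%:R / (opt tau)%:R)%:E
    | tau in [set tau | valid_input tau /\ opt tau = opt sigma]])).
  by apply: ereal_sup_ubound; exists sigma.
by apply: ereal_sup_ubound; exists (opt sigma) => //; apply: mV; exact: ltnW.
Qed.
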